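(* Let $B>0$ and $\alpha_m=(m+1)/(m+2)$ for $m\ge0$. Suppose a sequence $\{b_m\}_{m\ge0}$ of real numbers satisfies $$b_{m+1}\le\alpha_m^{1/2}b_m+\frac{B}{(m+2)^{1/2}}\qquad\text{for all } m\ge0,$$ and $$b_{m+1}\le\alpha_m^{1/2}\left(b_m+\frac{1}{(m+1)b_m}\right)\qquad\text{for all } m\ge 0 \text{ with } b_m>0.$$ Fix a constant $A\ge B/\sqrt2+\sqrt2$. Then $b_0\le A$ implies $b_m\le A$ for all $m\ge1$. In particular, if $B\le1/\sqrt2$, one can choose $A=2$. *)

(* Defs.v *)
From Stdlib Require Import Reals.
Open Scope R_scope.

Definition alpha (m : nat) : R := (INR m + 1) / (INR m + 2).

(* Main.v *)
(* With n = m + 1 and c = sqrt n * b_m, the two hypotheses say that the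
   normalised sequence grows in one step by at most min(B, 1/c), and the claim
   becomes c <= A sqrt n.  For B small compared with 1/n the increment B is
   enough, since A (sqrt (n+1) - sqrt n) is of order A / sqrt n.  Otherwise,
   c + 1/c is increasing for c >= 1, so the worst case is c = A sqrt n, where
   A^2 >= 2 + 2 B absorbs the error 1/(A^2 n); and for c <= 1 the bound
   1 + B < B + 2 <= A sqrt 2 suffices. *)

Require Import Defs.
From Stdlib Require Import Reals Lra Lia.
Open Scope R_scope.

Lemma add_inv_le (c d : R) : 1 <= c -> c <= d -> c + 1 / c <= d + 1 / d.
Proof.
  intros Hc Hd.
  assert (E : d + 1 / d - (c + 1 / c) = (d - c) * (1 - / (c * d)))
    by (field; lra).
  assert (H : / (c * d) <= 1) by (rewrite <- Rinv_1; apply Rinv_le_contravar; nra).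
  assert (0 <= (d - c) * (1 - / (c * d))) by (apply Rmult_le_pos; lra).
  lra.
Qed.

Lemma threshold_bounds (A B : R) :
  0 < B -> A >= B / sqrt 2 + sqrt 2 ->
  1 <= A /\ B + 2 <= A * sqrt 2 /\ 2 + 2 * B <= A * A.
Proof.
  intros HB HA.
  assert (Hq : sqrt 2 * sqrt 2 = 2) by (apply sqrt_sqrt; lra).
  assert (Hq1 : 1 < sqrt 2) by (rewrite <- sqrt_1; apply sqrt_lt_1; lra).
  assert (E : B / sqrt 2 * sqrt 2 = B) by (field; lra).
  assert (0 < B / sqrt 2) by (apply Rdiv_lt_0_compat; lra).
  set (u := B / sqrt 2) in *.
  repeat split; nra.
Qed.

Lemma normalised_step (A B s t c z : R) :
  0 < B -> A >= B / sqrt 2 + sqrt 2 ->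
  1 <= s -> 0 < t -> t * t = s * s + 1 ->
  c <= A * s -> z <= c + B -> (0 < c -> z <= c + 1 / c) ->
  z <= A * t.
Proof.
  intros HB HA Hs Ht Hst Hc Hz1 Hz2.
  destruct (threshold_bounds A B HB HA) as (HA1 & HAq & HA2).
  destruct (Rlt_le_dec (4 * B * (s * s)) 1) as [Hsmall | Hbig].
  - assert (t <= 2 * s) by nra.
    assert (B * (t + s) <= A) by nra.
    assert ((A * (t - s) - B) * (t + s) >= 0)
      by (replace ((A * (t - s) - B) * (t + s))
            with (A * (t * t - s * s) - B * (t + s)) by ring;
          rewrite Hst; nra).
    assert (A * (t - s) - B >= 0) by nra.
    lra.
  - destruct (Rle_lt_dec c 1) as [Hc1 | Hc1].
    + assert (sqrt 2 <= t)
        by (rewrite <- (sqrt_square t) by lra; apply sqrt_le_1; nra).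
      nra.
    + specialize (Hz2 ltac:(lra)).
      pose proof (add_inv_le c (A * s) ltac:(lra) Hc) as Hmono.
      set (d := A * s) in *.
      assert (Hd : 2 * (s * s) <= d * d)
        by (unfold d; replace (A * s * (A * s)) with (A * A * (s * s)) by ring; nra).
      assert (Hi : 1 / d * d = 1) by (field; lra).
      assert (Hi0 : 0 < 1 / d) by (apply Rdiv_lt_0_compat; lra).
      set (i := 1 / d) in *.
      assert (Hii : i * i <= 2 * B).
      { assert (1 <= 2 * B * (d * d)) by nra.
        assert (i * i * 1 <= i * i * (2 * B * (d * d)))
          by (apply Rmult_le_compat_l; nra).
        replace (i * i * (2 * B * (d * d))) with (2 * B * ((i * d) * (i * d))) in *
          by ring.
        rewrite Hi in *. lra. }
      assert (HAt : (A * t) * (A * t) = d * d + A * A)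
        by (unfold d; replace (A * t * (A * t)) with (A * A * (t * t)) by ring;
            rewrite Hst; ring).
      assert (0 < A * t) by nra.
      assert (d + i <= A * t) by (apply Rsqr_incr_0; unfold Rsqr; nra).
      lra.
Qed.

Lemma recursion_step (A B : R) (m : nat) (x y : R) :
  0 < B -> A >= B / sqrt 2 + sqrt 2 ->
  y <= sqrt (alpha m) * x + B / sqrt (INR m + 2) ->
  (0 < x -> y <= sqrt (alpha m) * (x + 1 / ((INR m + 1) * x))) ->
  x <= A -> y <= A.
Proof.
  intros HB HA H1 H2 Hx.
  pose proof (pos_INR m) as Hm.
  unfold alpha in *. rewrite sqrt_div in H1, H2 by lra.
  assert (Hs2 : sqrt (INR m + 1) * sqrt (INR m + 1) = INR m + 1)
    by (apply sqrt_sqrt; lra).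
  assert (Ht2 : sqrt (INR m + 2) * sqrt (INR m + 2) = INR m + 2)
    by (apply sqrt_sqrt; lra).
  assert (Hs : 1 <= sqrt (INR m + 1))
    by (rewrite <- sqrt_1 at 1; apply sqrt_le_1; lra).
  assert (Ht : 0 < sqrt (INR m + 2)) by (apply sqrt_lt_R0; lra).
  set (s := sqrt (INR m + 1)) in *. set (t := sqrt (INR m + 2)) in *.
  rewrite <- Hs2 in H2.
  apply Rmult_le_reg_r with t; [exact Ht|].
  apply (normalised_step A B s t (s * x)); try lra; try nra.
  - replace (s * x + B) with ((s / t * x + B / t) * t) by (field; lra).
    apply Rmult_le_compat_r; lra.
  - intros Hc. assert (Hx0 : 0 < x) by nra.
    replace (s * x + 1 / (s * x)) with (s / t * (x + 1 / (s * s * x)) * t)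
      by (field; repeat split; lra).
    apply Rmult_le_compat_r; [lra | exact (H2 Hx0)].
Qed.

Theorem lemma3 :
  forall (B : R) (b : nat -> R),
    0 < B ->
    (forall m : nat,
        b (S m) <= sqrt (alpha m) * b m + B / sqrt (INR m + 2)) ->
    (forall m : nat, 0 < b m ->
        b (S m) <= sqrt (alpha m) * (b m + 1 / ((INR m + 1) * b m))) ->
    (forall A : R, A >= B / sqrt 2 + sqrt 2 ->
        b 0%nat <= A -> forall m : nat, (1 <= m)%nat -> b m <= A)
    /\
    (B <= 1 / sqrt 2 ->
        2 >= B / sqrt 2 + sqrt 2 /\
        (b 0%nat <= 2 -> forall m : nat, (1 <= m)%nat -> b m <= 2)).
Proof.
  intros B b HB H1 H2.
  assert (main : forall A, A >= B / sqrt 2 + sqrt 2 -> b 0%nat <= A ->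
                 forall m, b m <= A).
  { intros A HA H0 m. induction m as [|m IH]; [exact H0|].
    exact (recursion_step A B m (b m) (b (S m)) HB HA (H1 m) (H2 m) IH). }
  split; [now auto|].
  intros HB2.
  assert (HA : 2 >= B / sqrt 2 + sqrt 2).
  { assert (Hq : sqrt 2 * sqrt 2 = 2) by (apply sqrt_sqrt; lra).
    assert (Hq0 : 0 < sqrt 2) by (apply sqrt_lt_R0; lra).
    assert (B / sqrt 2 <= 1 / sqrt 2 / sqrt 2)
      by (apply Rmult_le_compat_r; [left; now apply Rinv_0_lt_compat | exact HB2]).
    replace (1 / sqrt 2 / sqrt 2) with (1 / (sqrt 2 * sqrt 2)) in * by (field; lra).
    rewrite Hq in *. nra. }
  auto.
Qed.
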